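(* Let $V$ be an admissible $(\mathfrak g,K)$-module. On $K$-highest weight vectors of $V$ the following identities hold: 1. $[A_\beta,R]=B_{\alpha+\beta+\gamma}(1-H_\beta)$ 2. $[B_\beta,Q]=A_{\alpha+\beta+\gamma}(H_\beta-1)$ 3. $[B_{\alpha+\beta+\gamma},Q]=A_\beta(H_\alpha+H_\beta+H_\gamma+1)$ 4. $[A_{\alpha+\beta+\gamma},R]=-B_\beta(H_\alpha+H_\beta+H_\gamma+1)$ 5. $[B_{\alpha+\beta},Q]=-A_{\beta+\gamma}(H_\alpha+H_\beta)$ 6. $[B_{\beta+\gamma},Q]=-A_{\alpha+\beta}(H_\beta+H_\gamma)$ 7. $[A_{\alpha+\beta},R]=B_{\beta+\gamma}(H_\alpha+H_\beta)$ 8. $[A_{\beta+\gamma},R]=B_{\alpha+\beta}(H_\beta+H_\gamma)$ 9. $[A_\beta,Q]=0$ 10. $[A_{\alpha+\beta+\gamma},Q]=0$ 11. $[B_\beta,R]=0$ 12. $[B_{\alpha+\beta+\gamma},R]=0$ 13. $[A_{\alpha+\beta},Q]=0$ 14. $[A_{\beta+\gamma},Q]=0$ 15. $[B_{\alpha+\beta},R]=0$ 16. $[B_{\beta+\gamma},R]=0$ 17. $[A_{\alpha+\beta+\gamma},A_{\alpha+\beta}]=0$ 18. $[A_{\alpha+\beta+\gamma},A_{\beta+\gamma}]=0$ 19. $[A_\beta,A_{\alpha+\beta}]=0$ 20. $[A_\beta,A_{\beta+\gamma}]=0$ 21. $[B_{\alpha+\beta+\gamma},B_{\alpha+\beta}]=0$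 22. $[B_{\alpha+\beta+\gamma},B_{\beta+\gamma}]=0$ 23. $[B_\beta,B_{\alpha+\beta}]=0$ 24. $[B_\beta,B_{\beta+\gamma}]=0$ 25. $[A_{\alpha+\beta},B_{\beta+\gamma}]=0$ 26. $[A_{\beta+\gamma},B_{\alpha+\beta}]=0$ 27. $[A_\beta,B_{\alpha+\beta+\gamma}]=0$
   Context: Let $\mathfrak g=\mathfrak{sl}(4,\mathbb C)$ with matrix units $E_{ij}$, and let $K=S(U(2)\times U(2))$ (block diagonal) be the maximal compact subgroup of $SU(2,2)$. Put $H_\alpha=E_{11}-E_{22}$, $H_\beta=E_{22}-E_{33}$, $H_\gamma=E_{33}-E_{44}$; $X_\alpha=E_{12}$, $X_\beta=E_{23}$, $X_\gamma=E_{34}$, $X_{\alpha+\beta}=E_{13}$, $X_{\beta+\gamma}=E_{24}$, $X_{\alpha+\beta+\gamma}=E_{14}$; and $Y_\delta=X_\delta^{t}$ (transpose) for each positive root $\delta$. Put $H_0=H_\alpha+2H_\beta+H_\gamma$. $V$ is an admissible $(\mathfrak g,K)$-module. A $K$-highest weight vector of weight $(n,k,m)$ ($n,m\in\mathbb Z_{\ge0}$, $k\in\mathbb Z$) is $v\in V$ with $X_\alpha v=X_\gamma v=0$, $H_\alpha v=nv$, $H_\gamma v=mv$, $H_0v=kv$ (so $H_\beta v=\tfrac12(k-n-m)v$). The following operators map the span of $K$-highest weight vectors to itself (products are compositions, the rightmost factor acting first): $A_{\alpha+\beta+\gamma}=X_{\alpha+\beta+\gamma}$; $A_{\alpha+\beta}=X_{\alpha+\beta}(H_\gamma+1)+Y_\gamma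 X_{\alpha+\beta+\gamma}$; $A_{\beta+\gamma}=X_{\beta+\gamma}(H_\alpha+1)-Y_\alpha X_{\alpha+\beta+\gamma}$; $A_\beta=X_\beta(H_\alpha+1)(H_\gamma+1)-Y_\alpha X_{\alpha+\beta}(H_\gamma+1)+Y_\gamma X_{\beta+\gamma}(H_\alpha+1)-Y_\alpha Y_\gamma X_{\alpha+\beta+\gamma}$; $B_{\alpha+\beta+\gamma}=Y_{\alpha+\beta+\gamma}(H_\alpha+1)(H_\gamma+1)+Y_\alpha Y_{\beta+\gamma}(H_\gamma+1)-Y_\gamma Y_{\alpha+\beta}(H_\alpha+1)-Y_\alpha Y_\gamma Y_\beta$; $B_{\alpha+\beta}=Y_{\alpha+\beta}(H_\alpha+1)+Y_\alpha Y_\beta$; $B_{\beta+\gamma}=Y_{\beta+\gamma}(H_\gamma+1)-Y_\gamma Y_\beta$; $B_\beta=Y_\beta$; $Q=X_{\alpha+\beta}X_{\beta+\gamma}-X_\beta X_{\alpha+\beta+\gamma}$; $R=Y_{\alpha+\beta}Y_{\beta+\gamma}-Y_\beta Y_{\alpha+\beta+\gamma}$. Commutators are $[S,T]=ST-TS$. *)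

(* Defs.v *)
(* MathComp / MathComp-Analysis; the complex numbers are R[i] with
   R : realType, and all matrix indices are 1-based as in E_ij. *)
From HB Require Import structures.
From mathcomp Require Import all_boot all_order all_algebra.
From mathcomp Require Import all_classical all_reals all_analysis.
From mathcomp Require Import complex.
Import numFieldNormedType.Exports.
Import Order.TTheory GRing.Theory Num.Theory.

Set Implicit Arguments.
Unset Strict Implicit.
Unset Printing Implicit Defensive.

Local Open Scope classical_set_scope.
Local Open Scope ring_scope.

(* The type is R[i]; the ascription gives it the topology of a normed field. *)
Definition CC (R : realType) : numClosedFieldType := R[i].

Definition CCreal (R : realType) (t : R) : CC R := t%:C%C.

Section Groups.
Variable R : realType.
Local Notation C := (CC R).

Definition E (i j : nat) : 'M[C]_4 := delta_mx (inord i.-1) (inord j.-1).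

Definition sl4 : set 'M[C]_4 := [set X | \tr X = 0].

Definition block_diagonal (M : 'M[C]_4) : Prop :=
  forall i j : 'I_4, (i < 2)%N != (j < 2)%N -> M i j = 0.

(* S(U(2) x U(2)) *)
Definition KK : set 'M[C]_4 :=
  [set k | [/\ k \is unitarymx, block_diagonal k & \det k = 1]].

(* The (real) Lie algebra of KK: block diagonal, skew-Hermitian, trace 0. *)
Definition LieK : set 'M[C]_4 :=
  [set X | [/\ (X ^t*)%sesqui = - X, block_diagonal X & \tr X = 0]].

Definition expmx (X : 'M[C]_4) : 'M[C]_4 :=
  limn (series (fun k : nat => (k`!%:R : C)^-1 *: X ^+ k)).

End Groups.

Arguments E {R} i j.
Arguments sl4 {R}.
Arguments KK {R}.
Arguments LieK {R}.

(* The actions are functions on all 4 x 4 matrices; only their values on sl4,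
   resp. KK, are meaningful.  In gk_cont and gk_diff, the vectors involved lie
   in the finite-dimensional span of the KK-orbit of v, whose topology is the
   one defined by the restrictions of the linear forms of V. *)
Record gKModule (R : realType) := GKModule {
  gk_space :> lmodType (CC R);
  gk_g : 'M[CC R]_4 -> {linear gk_space -> gk_space};
  gk_K : 'M[CC R]_4 -> {linear gk_space -> gk_space};
  gk_gP : forall (a : CC R) (X Y : 'M[CC R]_4) (v : gk_space),
    sl4 X -> sl4 Y -> gk_g (a *: X + Y) v = a *: gk_g X v + gk_g Y v;
  gk_bracket : forall (X Y : 'M[CC R]_4) (v : gk_space),
    sl4 X -> sl4 Y ->
    gk_g (X *m Y - Y *m X) v = gk_g X (gk_g Y v) - gk_g Y (gk_g X v);
  gk_K1 : forall v : gk_space, gk_K 1%:M v = v;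
  gk_KM : forall (k l : 'M[CC R]_4) (v : gk_space),
    KK k -> KK l -> gk_K (k *m l) v = gk_K k (gk_K l v);
  gk_finite : forall v : gk_space,
    exists (d : nat) (e : 'I_d -> gk_space),
      forall k, KK k -> exists c : 'I_d -> CC R,
        gk_K k v = \sum_i c i *: e i;
  gk_cont : forall (v : gk_space) (f : {scalar gk_space}),
    {within KK, continuous (fun k : 'M[CC R]_4 => f (gk_K k v) : CC R)};
  gk_Ad : forall (k X : 'M[CC R]_4) (v : gk_space),
    KK k -> sl4 X ->
    gk_K k (gk_g X v) = gk_g (k *m X *m invmx k) (gk_K k v);
  gk_diff : forall (X : 'M[CC R]_4) (v : gk_space) (f : {scalar gk_space}),
    LieK X ->
    (fun t : R => (CCreal t)^-1 *
       (f (gk_K (expmx (CCreal t *: X)) v) - f v) : CC R) @ (0 : R)^'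
      --> (f (gk_g X v) : CC R)
}.

Section Admissible.
Variable R : realType.
Local Notation C := (CC R).

Definition K_representation (d : nat) (tau : 'M[C]_4 -> 'M[C]_d) : Prop :=
  [/\ tau 1%:M = 1%:M,
      forall k l, KK k -> KK l -> tau (k *m l) = tau k *m tau l
    & {within KK, continuous tau}].

Definition K_irreducible (d : nat) (tau : 'M[C]_4 -> 'M[C]_d) : Prop :=
  (0 < d)%N /\
  forall U : {vspace 'cV[C]_d},
    (forall k w, KK k -> w \in U -> tau k *m w \in U) ->
    U = 0%VS \/ U = fullv.

Definition K_intertwiner (V : gKModule R) (d : nat)
    (tau : 'M[C]_4 -> 'M[C]_d) (S : {linear 'cV[C]_d -> V}) : Prop :=
  forall k w, KK k -> S (tau k *m w) = gk_K V k (S w).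

(* Hom_K(tau, V) is finite-dimensional for every irreducible tau, i.e. every
   irreducible representation of KK has finite multiplicity in V. *)
Definition admissible (V : gKModule R) : Prop :=
  forall (d : nat) (tau : 'M[C]_4 -> 'M[C]_d),
    K_representation tau -> K_irreducible tau ->
    exists (r : nat) (T : 'I_r -> {linear 'cV[C]_d -> V}),
      forall S : {linear 'cV[C]_d -> V}, K_intertwiner tau S ->
        exists c : 'I_r -> C, forall w, S w = \sum_i c i *: T i w.

End Admissible.

(* Operators on V, multiplied by composition (rightmost factor first). *)
Declare Scope oper_scope.
Delimit Scope oper_scope with oper.
Notation "1" := idfun : oper_scope.
Notation "S + T" := (S \+ T) : oper_scope.
Notation "- S" := (\- S) : oper_scope.
Notation "S - T" := (S \- T) : oper_scope.
Notation "S * T" := (S \o T) : oper_scope.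

Section Operators.
Variables (R : realType) (V : gKModule R).
Local Open Scope oper_scope.

Definition H_a : V -> V := gk_g V (E 1 1 - E 2 2)%R.
Definition H_b : V -> V := gk_g V (E 2 2 - E 3 3)%R.
Definition H_g : V -> V := gk_g V (E 3 3 - E 4 4)%R.
Definition H_0 : V -> V :=
  gk_g V ((E 1 1 - E 2 2) + 2 *: (E 2 2 - E 3 3) + (E 3 3 - E 4 4))%R.

Definition X_a : V -> V := gk_g V (E 1 2).
Definition X_b : V -> V := gk_g V (E 2 3).
Definition X_g : V -> V := gk_g V (E 3 4).
Definition X_ab : V -> V := gk_g V (E 1 3).
Definition X_bg : V -> V := gk_g V (E 2 4).
Definition X_abg : V -> V := gk_g V (E 1 4).

Definition Y_a : V -> V := gk_g V (E 1 2)^T.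
Definition Y_b : V -> V := gk_g V (E 2 3)^T.
Definition Y_g : V -> V := gk_g V (E 3 4)^T.
Definition Y_ab : V -> V := gk_g V (E 1 3)^T.
Definition Y_bg : V -> V := gk_g V (E 2 4)^T.
Definition Y_abg : V -> V := gk_g V (E 1 4)^T.

Definition K_highest_weight (n : nat) (k : int) (m : nat) (v : V) : Prop :=
  X_a v = 0%R /\ X_g v = 0%R /\
  H_a v = (n%:R *: v)%R /\ H_g v = (m%:R *: v)%R /\ H_0 v = (k%:~R *: v)%R.

Definition A_abg : V -> V := X_abg.
Definition A_ab : V -> V := X_ab * (H_g + 1) + Y_g * X_abg.
Definition A_bg : V -> V := X_bg * (H_a + 1) - Y_a * X_abg.
Definition A_b : V -> V :=
  X_b * (H_a + 1) * (H_g + 1) - Y_a * X_ab * (H_g + 1)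
  + Y_g * X_bg * (H_a + 1) - Y_a * Y_g * X_abg.

Definition B_abg : V -> V :=
  Y_abg * (H_a + 1) * (H_g + 1) + Y_a * Y_bg * (H_g + 1)
  - Y_g * Y_ab * (H_a + 1) - Y_a * Y_g * Y_b.
Definition B_ab : V -> V := Y_ab * (H_a + 1) + Y_a * Y_b.
Definition B_bg : V -> V := Y_bg * (H_g + 1) - Y_g * Y_b.
Definition B_b : V -> V := Y_b.

Definition Q_op : V -> V := X_ab * X_bg - X_b * X_abg.
Definition R_op : V -> V := Y_ab * Y_bg - Y_b * Y_abg.

Definition opcomm (S T : V -> V) : V -> V := S * T - T * S.

End Operators.

Arguments H_a {R V}.
Arguments H_b {R V}.
Arguments H_g {R V}.
Arguments A_abg {R V}.
Arguments A_ab {R V}.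
Arguments A_bg {R V}.
Arguments A_b {R V}.
Arguments B_abg {R V}.
Arguments B_ab {R V}.
Arguments B_bg {R V}.
Arguments B_b {R V}.
Arguments Q_op {R V}.
Arguments R_op {R V}.

(* Main.v *)
Require Import Defs.
From mathcomp Require Import all_boot all_order all_algebra.
From mathcomp Require Import all_classical all_reals all_analysis.

(** The identities hold for every vector [v] killed by [X_a] and [X_g], and
    they are identities in the enveloping algebra of gl(4) modulo the left
    ideal generated by [E_12] and [E_34].  The action of sl(4) extends to
    gl(4), the centre acting by zero: [gl_act V (i, j)], the action of
    the traceless part of [E_ij], obeys the relations
      [e_ij, e_kl] = delta_jk e_il - delta_li e_kj    ([gl_act_bracket]),
    and every operator in the statement is an integral combination of words in
    these sixteen generators.

    Such a combination is rewritten in Poincare-Birkhoff-Witt form by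
    commuting its letters into a fixed order ([straighten]).  In the order
    [letter_rank] the units are arranged as lower triangular, upper triangular,
    diagonal, and finally [E_12] and [E_34], which stand next to [v] and
    contribute zero.  Keeping the diagonal units as letters makes all the
    coefficients integers and the weight of [v] irrelevant.  Soundness of the
    straightening ([straighten_sound]) uses the commutation relations only, and
    for each identity the difference of the two sides straightens to the empty
    combination, which is checked by evaluation ([straighten_eq]). *)

Set Implicit Arguments.
Unset Strict Implicit.
Unset Printing Implicit Defensive.

Import GRing.Theory.
Local Open Scope ring_scope.

(** * Straightening words in the matrix units *)

Section Straightening.
Variable N : nat.

(** The letter [(i, j)] stands for the matrix unit [E_ij] of gl(N), and a word
    for a product of units, whose last letter acts first. *)
Definition letter := ('I_N * 'I_N)%type.
Definition word := seq letter.

(** Integral combinations of words: the elements of the free ring on the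
    matrix units, without any normalisation. *)
Definition comb := seq (int * word).

Definition comb1 : comb := [:: (1, [::])].
Definition comb_letter (g : letter) : comb := [:: (1, [:: g])].
Definition comb_scale (c : int) (p : comb) : comb :=
  [seq (c * t.1, t.2) | t <- p].
Definition comb_mul (p q : comb) : comb :=
  [seq (s.1 * t.1, s.2 ++ t.2) | s <- p, t <- q].

(** [comb_insert t p] is [t + p], where [t] is merged with the term of [p] on
    the same word and cancelling terms are removed. *)
Fixpoint comb_insert (t : int * word) (p : comb) : comb :=
  if p is s :: p' then
    if s.2 == t.2 then
      if s.1 + t.1 == 0 then p' else (s.1 + t.1, s.2) :: p'
    else s :: comb_insert t p'
  else [:: t].
Definition comb_add (p q : comb) : comb := foldr comb_insert q p.

(** The linear extension of [f] to combinations, applied to [p]. *)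
Definition comb_bind (f : word -> comb) (p : comb) : comb :=
  foldr (fun t => comb_add (comb_scale t.1 (f t.2))) [::] p.

(** [E_ij E_kl - E_kl E_ij = delta_jk E_il - delta_li E_kj] *)
Definition bracket (g h : letter) : seq (int * letter) :=
  (if g.2 == h.1 then [:: (1, (g.1, h.2))] else [::]) ++
  (if h.2 == g.1 then [:: (- 1, (h.1, g.2))] else [::]).

Variables (rank : letter -> nat) (kills : pred letter).

(** The product of the letter [g] and the sorted word [w], straightened; a
    word that ends with a letter in [kills] is zero.  The number [fuel] bounds
    the depth of the recursion; when it is exhausted the product is left as it
    is. *)
Fixpoint letter_mul (fuel : nat) (g : letter) (w : word) : comb :=
  if fuel is fuel'.+1 then
    if w is h :: w' then
      if (rank g <= rank h)%N then [:: (1, g :: w)]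
      else
        comb_add (comb_bind (letter_mul fuel' h) (letter_mul fuel' g w'))
          (foldr (fun s => comb_add (comb_scale s.1 (letter_mul fuel' s.2 w')))
             [::] (bracket g h))
    else if kills g then [::] else [:: (1, [:: g])]
  else [:: (1, g :: w)].

(** Straightening multiplies by the letters of a word from right to left. *)
Definition straighten_word (fuel : nat) (w : word) : comb :=
  foldr (fun g => comb_bind (letter_mul fuel g)) comb1 w.
Definition straighten (fuel : nat) (p : comb) : comb :=
  comb_bind (straighten_word fuel) p.

Variables (V : zmodType) (e : letter -> {additive V -> V}).

(** Words and combinations act on [V] when the letter [g] acts by [e g]. *)
Definition word_act (w : word) (u : V) : V := foldr (fun g => e g) u w.
Definition comb_act (p : comb) (u : V) : V :=
  \sum_(t <- p) word_act t.2 u *~ t.1.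

Lemma word_actMz w u c : word_act w (u *~ c) = word_act w u *~ c.
Proof. by elim: w => //= g w ->; rewrite raddfMz. Qed.

Lemma word_act_sum w (I : Type) (r : seq I) (F : I -> V) :
  word_act w (\sum_(i <- r) F i) = \sum_(i <- r) word_act w (F i).
Proof. by elim: w => //= g w ->; rewrite raddf_sum. Qed.

Lemma comb_act0 u : comb_act [::] u = 0.
Proof. exact: big_nil. Qed.

Lemma comb_act1 u : comb_act comb1 u = u.
Proof. exact: big_seq1. Qed.

Lemma comb_act_letter g u : comb_act (comb_letter g) u = e g u.
Proof. exact: big_seq1. Qed.

Lemma comb_act_cons t p u :
  comb_act (t :: p) u = word_act t.2 u *~ t.1 + comb_act p u.
Proof. exact: big_cons. Qed.

Lemma comb_act_cat p q u : comb_act (p ++ q) u = comb_act p u + comb_act q u.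
Proof. exact: big_cat. Qed.

Lemma comb_act_scale c p u : comb_act (comb_scale c p) u = comb_act p u *~ c.
Proof.
rewrite /comb_act big_map mulrz_suml; apply: eq_bigr => t _ /=.
by rewrite mulrC mulrzA.
Qed.

Lemma comb_act_mul p q u :
  comb_act (comb_mul p q) u = comb_act p (comb_act q u).
Proof.
rewrite /comb_act /comb_mul big_allpairs_dep; apply: eq_bigr => s _.
rewrite word_act_sum mulrz_suml; apply: eq_bigr => t _ /=.
by rewrite word_actMz /word_act foldr_cat mulrC mulrzA.
Qed.

Lemma comb_act_insert t p u :
  comb_act (comb_insert t p) u = word_act t.2 u *~ t.1 + comb_act p u.
Proof.
elim: p => [|s p IHp] /=; first by rewrite comb_act_cons.
case: eqP => [eq_w|_]; last by rewrite !comb_act_cons IHp addrCA.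
rewrite comb_act_cons -eq_w addrA -mulrzDr [t.1 + _]addrC.
by case: eqP => [->|_]; rewrite ?add0r ?comb_act_cons.
Qed.

Lemma comb_act_add p q u :
  comb_act (comb_add p q) u = comb_act p u + comb_act q u.
Proof.
elim: p => [|t p IHp] /=; first by rewrite comb_act0 add0r.
by rewrite comb_act_insert IHp comb_act_cons addrA.
Qed.

Lemma comb_act_bind f p u :
  comb_act (comb_bind f p) u = \sum_(t <- p) comb_act (f t.2) u *~ t.1.
Proof.
elim: p => [|t p IHp] /=; first by rewrite big_nil comb_act0.
by rewrite comb_act_add IHp comb_act_scale big_cons.
Qed.

Hypothesis e_bracket : forall g h u,
  e g (e h u) = e h (e g u) + \sum_(s <- bracket g h) e s.2 u *~ s.1.
Variable v : V.
Hypothesis v_killed : forall g, kills g -> e g v = 0.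

Lemma letter_mul_sound fuel g w :
  comb_act (letter_mul fuel g w) v = e g (word_act w v).
Proof.
elim: fuel g w => [|fuel IH] g w /=; first exact: big_seq1.
case: w => [|h w].
  case: ifP => [/v_killed|_]; last exact: big_seq1.
  by rewrite comb_act0.
case: ifP => _; first exact: big_seq1.
rewrite comb_act_add /= e_bracket; congr (_ + _).
  rewrite comb_act_bind -IH [in RHS]/comb_act raddf_sum; apply: eq_bigr => t _.
  by rewrite IH raddfMz.
elim: (bracket g h) => [|s r IHr] /=; first by rewrite big_nil comb_act0.
by rewrite big_cons comb_act_add comb_act_scale IH IHr.
Qed.

Lemma straighten_sound fuel p : comb_act (straighten fuel p) v = comb_act p v.
Proof.
rewrite comb_act_bind; apply: eq_bigr => -[c w] _ /=; congr (_ *~ _).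
elim: w => [|g w IHw] /=; first exact: comb_act1.
rewrite comb_act_bind -IHw [in RHS]/comb_act raddf_sum; apply: eq_bigr => t _.
by rewrite letter_mul_sound raddfMz.
Qed.

(** The operator [S] is the action of [p]. *)
Definition represents (p : comb) (S : V -> V) := forall u, S u = comb_act p u.

Lemma represents1 : represents comb1 idfun.
Proof. by move=> u; rewrite comb_act1. Qed.

Lemma representsD p q S T :
  represents p S -> represents q T -> represents (p ++ q) (S \+ T).
Proof. by move=> pS qT u; rewrite comb_act_cat -pS -qT. Qed.

Lemma representsN p S :
  represents p S -> represents (comb_scale (- 1) p) (\- S).
Proof. by move=> pS u; rewrite comb_act_scale mulrN1z -pS. Qed.

Lemma representsB p q S T :
    represents p S -> represents q T ->
  represents (p ++ comb_scale (- 1) q) (S \- T).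
Proof.
by move=> pS qT u; rewrite comb_act_cat comb_act_scale mulrN1z -pS -qT.
Qed.

Lemma representsM p q S T :
  represents p S -> represents q T -> represents (comb_mul p q) (S \o T).
Proof. by move=> pS qT u; rewrite comb_act_mul -qT -pS. Qed.

Lemma straighten_eq0 fuel p S :
  represents p S -> straighten fuel p = [::] -> S v = 0.
Proof. by move=> pS p0; rewrite pS -(straighten_sound fuel) p0 comb_act0. Qed.

Lemma straighten_eq fuel p q S T :
    represents p S -> represents q T ->
  straighten fuel (p ++ comb_scale (- 1) q) = [::] -> S v = T v.
Proof.
move=> pS qT; move: (representsB pS qT) => /straighten_eq0 pq_eq0 /pq_eq0.
exact: subr0_eq.
Qed.

End Straightening.

(** * Extension of the action from sl(4) to gl(4) *)

Section GlAction.
Variables (R : realType) (V : gKModule R).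
Local Notation C := (CC R).

Lemma sl4E (X : 'M[C]_4) : sl4 X = (\tr X = 0).
Proof. by []. Qed.

Lemma gk_gB (X Y : 'M[C]_4) u :
  sl4 X -> sl4 Y -> gk_g V (X - Y) u = gk_g V X u - gk_g V Y u.
Proof.
move=> slX slY; have -> : X - Y = -1 *: Y + X by rewrite scaleN1r addrC.
by rewrite gk_gP// scaleN1r addrC.
Qed.

Lemma gk_g0 u : gk_g V 0 u = 0.
Proof.
have sl0 : sl4 (0 : 'M[C]_4) by rewrite sl4E raddf0.
by rewrite -{1}(subrr 0) gk_gB// subrr.
Qed.

(** The traceless part of the matrix unit [E_ij]. *)
Definition unit0 (g : letter 4) : 'M[C]_4 :=
  delta_mx g.1 g.2 - ((g.1 == g.2)%:R / 4%:R)%:M.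

Lemma unit0_sl4 g : sl4 (unit0 g).
Proof.
rewrite sl4E /unit0 raddfB /= mxtrace_scalar -[_ *+ 4]mulr_natr.
rewrite divfK ?pnatr_eq0//.
rewrite -[delta_mx _ _](mul_delta_mx (0 : 'I_1)) mxtrace_mulC.
by rewrite mul_delta_mx_cond raddfMn /= trace_mx11 mxE !eqxx eq_sym subrr.
Qed.

Lemma commutator_scalar_shift (A B : 'M[C]_4) a b :
  (A - a%:M) *m (B - b%:M) - (B - b%:M) *m (A - a%:M) = A *m B - B *m A.
Proof.
rewrite !mulmxBl !mulmxBr !mul_scalar_mx !mul_mx_scalar.
rewrite !scale_scalar_mx [b * a]mulrC.
have subrCAC (W X Y Z : 'M[C]_4) : W - X - (Y - Z) = W - (X + Y - Z).
  by rewrite -!addrA -!opprD addrA.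
rewrite (subrCAC (A *m B)) (subrCAC (B *m A)) [a *: B + b *: A]addrC.
by rewrite [- (B *m A - _)]opprB addrA subrK.
Qed.

(** The scalar parts cancel, since [bracket] only has a diagonal term
    [E_ii - E_jj] or units off the diagonal. *)
Lemma unit0_bracket g h :
  unit0 g *m unit0 h - unit0 h *m unit0 g =
  \sum_(s <- bracket g h) unit0 s.2 *~ s.1.
Proof.
case: g h => [i j] [k l]; rewrite /unit0 commutator_scalar_shift.
rewrite !mul_delta_mx_cond big_cat /=.
case: (eqVneq j k) => [<-|k_neq_j]; case: (eqVneq l i) => [->|l_neq_i];
  rewrite ?big_cons !big_nil /= ?addr0 ?mulr1z ?mulrN1z ?mulr0n
    ?mulr1n.
- by rewrite !eqxx opprB addrA subrK.
- by rewrite subr0 eq_sym (negPf l_neq_i) mul0r [_%:M]raddf0 subr0.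
- by rewrite eq_sym (negPf k_neq_j) mul0r [_%:M]raddf0 subr0.
- by rewrite subr0.
Qed.

(** The action of the matrix unit [g] when the centre of gl(4) acts by zero. *)
Definition gl_act (g : letter 4) : {additive V -> V} := gk_g V (unit0 g).

Lemma gl_act_bracket g h u :
  gl_act g (gl_act h u) =
  gl_act h (gl_act g u) + \sum_(s <- bracket g h) gl_act s.2 u *~ s.1.
Proof.
have sl_g := unit0_sl4 g; have sl_h := unit0_sl4 h.
apply/eqP; rewrite addrC -subr_eq /gl_act -gk_bracket// unit0_bracket.
apply/eqP; suff: sl4 (\sum_(s <- bracket g h) unit0 s.2 *~ s.1) /\
    gk_g V (\sum_(s <- bracket g h) unit0 s.2 *~ s.1) u =
    \sum_(s <- bracket g h) gk_g V (unit0 s.2) u *~ s.1 by case.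
elim: (bracket g h) => [|s r [sl_r IHr]].
  by rewrite !big_nil gk_g0 sl4E raddf0.
rewrite !big_cons -[unit0 s.2 *~ s.1]scaler_int; split.
  by rewrite sl4E raddfD /= mxtraceZ unit0_sl4 mulr0 add0r.
by rewrite gk_gP ?scaler_int ?IHr//; exact: unit0_sl4.
Qed.

Lemma represents_offdiag i j :
  i != j -> represents gl_act (comb_letter (i, j)) (gk_g V (delta_mx i j)).
Proof.
move=> /negPf i_neq_j u.
by rewrite comb_act_letter /gl_act /unit0 /= i_neq_j mul0r [_%:M]raddf0 subr0.
Qed.

Lemma represents_diagB i j :
  represents gl_act
    (comb_letter (i, i) ++ comb_scale (- 1) (comb_letter (j, j)))
    (gk_g V (delta_mx i i - delta_mx j j)).
Proof.
move=> u; rewrite comb_act_cat comb_act_scale !comb_act_letter mulrN1z /gl_act.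
rewrite -gk_gB; [|exact: unit0_sl4..].
by rewrite /unit0 /= !eqxx opprB addrA subrK.
Qed.

End GlAction.

(** * The operators as combinations of words *)

Definition i1 : 'I_4 := @Ordinal 4 0 isT.
Definition i2 : 'I_4 := @Ordinal 4 1 isT.
Definition i3 : 'I_4 := @Ordinal 4 2 isT.
Definition i4 : 'I_4 := @Ordinal 4 3 isT.

(** The units killing a vector that is highest for the block diagonal
    subalgebra: [E_12] and [E_34]. *)
Definition letter_kills : pred (letter 4) := pred2 (i1, i2) (i3, i4).

(** The order of the Poincare-Birkhoff-Witt form: four blocks of units, each
    ordered lexicographically. *)
Definition letter_rank (g : letter 4) : nat :=
  let block := if letter_kills g then 3 else if g.1 == g.2 then 2
               else if (g.1 < g.2)%N then 1 else 0 in
  (16 * block + 4 * g.1 + g.2)%N.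

Section Operators.
Variables (R : realType) (V : gKModule R).
Local Notation rep := (represents (@gl_act R V)).

(** The indices of [E] are natural numbers counted from 1, and those of
    [letter 4] are ordinals, whose values start at 0. *)
Lemma E_unit (i j : 'I_4) : E i.+1 j.+1 = delta_mx i j :> 'M[CC R]_4.
Proof. by rewrite /E !inord_val. Qed.

Lemma represents_X_b : rep (comb_letter (i2, i3)) (@X_b R V).
Proof. by rewrite /X_b (E_unit i2 i3); exact: represents_offdiag. Qed.

Lemma represents_X_ab : rep (comb_letter (i1, i3)) (@X_ab R V).
Proof. by rewrite /X_ab (E_unit i1 i3); exact: represents_offdiag. Qed.

Lemma represents_X_bg : rep (comb_letter (i2, i4)) (@X_bg R V).
Proof. by rewrite /X_bg (E_unit i2 i4); exact: represents_offdiag. Qed.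

Lemma represents_X_abg : rep (comb_letter (i1, i4)) (@X_abg R V).
Proof. by rewrite /X_abg (E_unit i1 i4); exact: represents_offdiag. Qed.

Lemma represents_Y_a : rep (comb_letter (i2, i1)) (@Y_a R V).
Proof.
by rewrite /Y_a (E_unit i1 i2) trmx_delta; exact: represents_offdiag.
Qed.

Lemma represents_Y_b : rep (comb_letter (i3, i2)) (@Y_b R V).
Proof.
by rewrite /Y_b (E_unit i2 i3) trmx_delta; exact: represents_offdiag.
Qed.

Lemma represents_Y_g : rep (comb_letter (i4, i3)) (@Y_g R V).
Proof.
by rewrite /Y_g (E_unit i3 i4) trmx_delta; exact: represents_offdiag.
Qed.

Lemma represents_Y_ab : rep (comb_letter (i3, i1)) (@Y_ab R V).
Proof.
by rewrite /Y_ab (E_unit i1 i3) trmx_delta; exact: represents_offdiag.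
Qed.

Lemma represents_Y_bg : rep (comb_letter (i4, i2)) (@Y_bg R V).
Proof.
by rewrite /Y_bg (E_unit i2 i4) trmx_delta; exact: represents_offdiag.
Qed.

Lemma represents_Y_abg : rep (comb_letter (i4, i1)) (@Y_abg R V).
Proof.
by rewrite /Y_abg (E_unit i1 i4) trmx_delta; exact: represents_offdiag.
Qed.

Lemma represents_H_a :
  rep (comb_letter (i1, i1) ++ comb_scale (- 1) (comb_letter (i2, i2)))
    (@H_a R V).
Proof.
by rewrite /H_a (E_unit i1 i1) (E_unit i2 i2); exact: represents_diagB.
Qed.

Lemma represents_H_b :
  rep (comb_letter (i2, i2) ++ comb_scale (- 1) (comb_letter (i3, i3)))
    (@H_b R V).
Proof.
by rewrite /H_b (E_unit i2 i2) (E_unit i3 i3); exact: represents_diagB.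
Qed.

Lemma represents_H_g :
  rep (comb_letter (i3, i3) ++ comb_scale (- 1) (comb_letter (i4, i4)))
    (@H_g R V).
Proof.
by rewrite /H_g (E_unit i3 i3) (E_unit i4 i4); exact: represents_diagB.
Qed.

End Operators.

(** * Verification of the identities *)

(** Finds a combination that represents a given operator, by recursion on the
    way in which the operator is built. *)
Ltac represent :=
  rewrite /opcomm /A_b /A_ab /A_bg /A_abg /B_b /B_ab /B_bg /B_abg /Q_op /R_op;
  repeat lazymatch goal with
  | |- represents _ _ (_ \o _) => apply: representsM
  | |- represents _ _ (_ \+ _) => apply: representsD
  | |- represents _ _ (_ \- _) => apply: representsB
  | |- represents _ _ (\- _) => apply: representsN
  | |- represents _ _ idfun => exact: represents1
  | |- represents _ _ (@X_b _ _) => exact: represents_X_b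
  | |- represents _ _ (@X_ab _ _) => exact: represents_X_ab
  | |- represents _ _ (@X_bg _ _) => exact: represents_X_bg
  | |- represents _ _ (@X_abg _ _) => exact: represents_X_abg
  | |- represents _ _ (@Y_a _ _) => exact: represents_Y_a
  | |- represents _ _ (@Y_b _ _) => exact: represents_Y_b
  | |- represents _ _ (@Y_g _ _) => exact: represents_Y_g
  | |- represents _ _ (@Y_ab _ _) => exact: represents_Y_ab
  | |- represents _ _ (@Y_bg _ _) => exact: represents_Y_bg
  | |- represents _ _ (@Y_abg _ _) => exact: represents_Y_abg
  | |- represents _ _ (@H_a _ _) => exact: represents_H_a
  | |- represents _ _ (@H_b _ _) => exact: represents_H_b
  | |- represents _ _ (@H_g _ _) => exact: represents_H_g
  end.

(** Proves [S v = 0] or [S v = T v] by straightening [S], resp. [S - T]. *)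
Ltac identity act_bracket killed :=
  (* Too little fuel would leave words unsorted, and the evaluation might not
     end in [::]; soundness does not depend on it. *)
  lazymatch goal with
  | |- _ = 0 =>
      eapply (@straighten_eq0 4 letter_rank letter_kills _ _ act_bracket _
                killed 30); [represent | vm_compute; reflexivity]
  | |- _ =>
      eapply (@straighten_eq 4 letter_rank letter_kills _ _ act_bracket _
                killed 30); [represent | represent | vm_compute; reflexivity]
  end.

Theorem proposition3 (R : realType) (V : gKModule R) (hV : admissible V)
    (n : nat) (k : int) (m : nat) (v : V) (hv : K_highest_weight n k m v) :
  (opcomm A_b R_op v = (B_abg * (1 - H_b))%oper v) /\
  (opcomm B_b Q_op v = (A_abg * (H_b - 1))%oper v) /\
  (opcomm B_abg Q_op v = (A_b * (H_a + H_b + H_g + 1))%oper v) /\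
  (opcomm A_abg R_op v = (- (B_b * (H_a + H_b + H_g + 1)))%oper v) /\
  (opcomm B_ab Q_op v = (- (A_bg * (H_a + H_b)))%oper v) /\
  (opcomm B_bg Q_op v = (- (A_ab * (H_b + H_g)))%oper v) /\
  (opcomm A_ab R_op v = (B_bg * (H_a + H_b))%oper v) /\
  (opcomm A_bg R_op v = (B_ab * (H_b + H_g))%oper v) /\
  (opcomm A_b Q_op v = 0%R) /\
  (opcomm A_abg Q_op v = 0%R) /\
  (opcomm B_b R_op v = 0%R) /\
  (opcomm B_abg R_op v = 0%R) /\
  (opcomm A_ab Q_op v = 0%R) /\
  (opcomm A_bg Q_op v = 0%R) /\
  (opcomm B_ab R_op v = 0%R) /\
  (opcomm B_bg R_op v = 0%R) /\
  (opcomm A_abg A_ab v = 0%R) /\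
  (opcomm A_abg A_bg v = 0%R) /\
  (opcomm A_b A_ab v = 0%R) /\
  (opcomm A_b A_bg v = 0%R) /\
  (opcomm B_abg B_ab v = 0%R) /\
  (opcomm B_abg B_bg v = 0%R) /\
  (opcomm B_b B_ab v = 0%R) /\
  (opcomm B_b B_bg v = 0%R) /\
  (opcomm A_ab B_bg v = 0%R) /\
  (opcomm A_bg B_ab v = 0%R) /\
  (opcomm A_b B_abg v = 0%R).
Proof.
case: hv => Xa_v [Xg_v _].
have killed g : letter_kills g -> gl_act V g v = 0.
  rewrite -comb_act_letter => /orP[]/eqP->.
    by rewrite -[LHS]represents_offdiag// -Xa_v /X_a (E_unit _ i1 i2).
  by rewrite -[LHS]represents_offdiag// -Xg_v /X_g (E_unit _ i3 i4).
have act_bracket := @gl_act_bracket R V.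
do 26 (split; first identity act_bracket killed).
identity act_bracket killed.
Qed.
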